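(* Let $R$ be a (commutative) domain, and let $m\colon \mathcal{F}\to\mathcal{G}$ be a morphism of Green functors with inflation (GFIs) over $R$, with kernel $\mathcal{K}$, such that $\mathcal{F}(H)$ is $R$-torsion free for all finite groups $H$. Let $G$ be a finite group, and let $D(G)$ be an $R$-subalgebra of the centre of $\mathcal{F}(G)$ such that the $R$-module $\mathcal{F}(G)$ is generated by $\mathcal{I}_{\mathcal{F}}(G)$ and $D(G)$. Suppose that $G$ is non-trivial, and that $\mathrm{Prim}_{\mathcal{K},D}(G)$ is non-trivial. Then $G$ is an extension of the form $1\to S^d\to G\to H\to 1$, where $S$ is a finite simple group, $d\geq 1$ is an integer, and $H$ is primordial for $\mathrm{Im}\, m$.
   Context: Rings are associative with a unit element. An $R$-algebra is a ring $A$ with a ring homomorphism from $R$ to the centre of $A$; subalgebras contain $1$ and homomorphisms preserve $1$. Simple groups may be abelian (cyclic of prime order). A global Mackey functor with inflation (MFI) $\mathcal{F}$ over $R$ consists of: an $R$-module $\mathcal{F}(G)$ for every finite group $G$; an $R$-module homomorphism $\mathcal{F}_*(\alpha)\colon\mathcal{F}(H)\to\mathcal{F}(G)$ for every monomorphism $\alpha\colon H\to G$ of finite groups; an $R$-module homomorphism $\mathcal{F}^*(\epsilon)\colon\mathcal{F}(G)\to\mathcal{F}(H)$ for every homomorphism $\epsilon\colon H\to G$ of finite groups; such that: (MFI 1) $\mathcal{F}_*(\alpha\beta)=\mathcal{F}_*(\alpha)\mathcal{F}_*(\beta)$ for composable monomorphisms; (MFI 2) $\mathcal{F}^*(\alpha\beta)=\mathcal{F}^*(\beta)\mathcal{F}^*(\alpha)$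 for composable homomorphisms; (MFI 3) $\mathcal{F}^*(\alpha)=\mathcal{F}_*(\alpha)=1$ for inner automorphisms $\alpha$; (MFI 4) $\mathcal{F}_*(\alpha)=\mathcal{F}^*(\alpha^{-1})$ for automorphisms $\alpha$; (MFI 5) for monomorphisms $\alpha\colon H\to G$, $\beta\colon K\to G$, $\mathcal{F}^*(\beta)\mathcal{F}_*(\alpha)=\sum_{g\in\alpha(H)\backslash G/\beta(K)}\mathcal{F}_*(\phi_g)\mathcal{F}^*(\psi_g)$, where $\phi_g\colon \alpha(H)\cap g\beta(K)g^{-1}\to K$ is $x\mapsto \beta^{-1}(g^{-1}xg)$ and $\psi_g\colon\alpha(H)\cap g\beta(K)g^{-1}\to H$ is $x\mapsto\alpha^{-1}(x)$; (MFI 6) for every commutative square $\delta\alpha=\beta\epsilon$ with epimorphisms $\epsilon\colon H\to\bar H$, $\delta\colon G\to\bar G$ and monomorphisms $\alpha\colon H\to G$, $\beta\colon\bar H\to\bar G$ that is cartesian, i.e. $\alpha(H)=\delta^{-1}(\beta(\bar H))$, one has $\mathcal{F}^*(\delta)\mathcal{F}_*(\beta)=\mathcal{F}_*(\alpha)\mathcal{F}^*(\epsilon)$. For a subgroup $H\le G$ with inclusion $\alpha$, write $\mathrm{Ind}_{G/H}=\mathcal{F}_*(\alpha)$ and $\mathrm{Res}_{G/H}=\mathcal{F}^*(\alpha)$; for a normal subgroup $N$ with quotient map $\epsilon\colon G\to G/N$, write $\mathrm{Inf}_{G/N}=\mathcal{F}^*(\epsilon)$. A Green functor with inflation (GFI)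 over $R$ is an MFI $\mathcal{F}$ over $R$ such that each $\mathcal{F}(G)$ is an $R$-algebra, each $\mathcal{F}^*(\alpha)$ is an $R$-algebra homomorphism, and for every monomorphism $\alpha\colon H\to G$ and all $x\in\mathcal{F}(H)$, $y\in\mathcal{F}(G)$: $\mathcal{F}_*(\alpha)(x)\cdot y=\mathcal{F}_*(\alpha)(x\cdot\mathcal{F}^*(\alpha)(y))$ and $y\cdot\mathcal{F}_*(\alpha)(x)=\mathcal{F}_*(\alpha)(\mathcal{F}^*(\alpha)(y)\cdot x)$. A morphism $m\colon\mathcal{F}\to\mathcal{G}$ of GFIs is a collection of $R$-algebra homomorphisms $m_G\colon\mathcal{F}(G)\to\mathcal{G}(G)$, one for each finite group $G$, commuting with all $\mathcal{F}_*,\mathcal{G}_*$ and $\mathcal{F}^*,\mathcal{G}^*$. Its kernel $\mathcal{K}$, $\mathcal{K}(G)=\ker m_G$, and its image $\mathrm{Im}\,m$, $(\mathrm{Im}\,m)(G)=m_G(\mathcal{F}(G))$, carry the structure maps restricted from $\mathcal{F}$ and $\mathcal{G}$, respectively; $\mathcal{K}$ is an MFI and each $\mathcal{K}(G)$ is an ideal of $\mathcal{F}(G)$, and $\mathrm{Im}\,m$ is a GFI. For an MFI $\mathcal{M}$, $\mathcal{I}_{\mathcal{M}}(G)=\sum_{H\lneq G}\mathrm{Ind}_{G/H}\mathcal{M}(H)$. A finite group $G$ is primordial for $\mathcal{M}$ if either $G$ is trivial or $\mathcal{M}(G)\neq\mathcal{I}_{\mathcal{M}}(G)$. Finally, $\mathrm{Imprim}_{\mathcal{K},D}(G)=D(G)\cdot\big(\sum_{H\lneq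 G}\mathrm{Ind}_{G/H}\mathcal{K}(H)+\sum_{1\neq N\trianglelefteq G}\mathrm{Inf}_{G/N}\mathcal{K}(G/N)\big)\subseteq\mathcal{K}(G)$ (the $R$-submodule generated by the products, taken in $\mathcal{F}(G)$), and $\mathrm{Prim}_{\mathcal{K},D}(G)=\mathcal{K}(G)/\mathrm{Imprim}_{\mathcal{K},D}(G)$. *)

(* Defs.v *)
From HB Require Import structures.
From mathcomp Require Import all_boot all_order all_algebra all_fingroup.
From mathcomp Require Import all_solvable boolp.

Set Implicit Arguments.
Unset Strict Implicit.
Unset Printing Implicit Defensive.

Import GroupScope GRing.Theory.
Local Open Scope ring_scope.

(* MathComp's [algType] excludes the zero ring, which has to be allowed here
   (for instance as a value of the target of a morphism of Green functors). *)
Record algebra (R : comNzRingType) := Algebra {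
  alg_ring : pzRingType;
  alg_map : {rmorphism R -> alg_ring};
  alg_mapC : forall r x, alg_map r * x = x * alg_map r
}.

Definition alg_sort (R : comNzRingType) (A : algebra R) : Type := alg_ring A.
Coercion alg_sort : algebra >-> Sortclass.

Section AlgebraTheory.
Variables (R : comNzRingType) (A : algebra R).

HB.instance Definition _ := GRing.PzRing.copy (alg_sort A) (alg_ring A).

Definition alg_scale (r : R) (x : A) : A := (alg_map A r : A) * x.

Fact alg_scaleA a b x : alg_scale a (alg_scale b x) = alg_scale (a * b) x.
Proof. by rewrite /alg_scale mulrA rmorphM. Qed.
Fact alg_scale1 : left_id 1 alg_scale.
Proof. by move=> x; rewrite /alg_scale rmorph1 mul1r. Qed.
Fact alg_scaleDr : right_distributive alg_scale +%R.
Proof. by move=> a x y; rewrite /alg_scale mulrDr. Qed.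
Fact alg_scaleDl x : {morph alg_scale^~ x : a b / a + b}.
Proof. by move=> a b; rewrite /alg_scale rmorphD mulrDl. Qed.

HB.instance Definition _ := GRing.Zmodule_isLmodule.Build R (alg_sort A)
  alg_scaleA alg_scale1 alg_scaleDr alg_scaleDl.

Lemma alg_scaleE r (x : A) : r *: x = (alg_map A r : A) * x.
Proof. by []. Qed.

Lemma alg_scaleAl r (x y : A) : r *: (x * y) = (r *: x) * y.
Proof. by rewrite !alg_scaleE mulrA. Qed.

Lemma alg_scaleAr r (x y : A) : r *: (x * y) = x * (r *: y).
Proof. by rewrite !alg_scaleE !mulrA (alg_mapC r (x : alg_ring A)). Qed.

End AlgebraTheory.

Section Span.
Variables (R : comNzRingType) (V : lmodType R) (S : V -> Prop).

Definition Rspan : {pred V} := fun v =>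
  `[< exists n (r : 'I_n -> R) (s : 'I_n -> V),
        (forall i, S (s i)) /\ v = \sum_(i < n) r i *: s i >].

Fact Rspan_submod_closed : submod_closed Rspan.
Proof.
split.
  apply/asboolP; exists 0%N, (fun=> 0), (fun=> 0); split=> [[]//|].
  by rewrite big_ord0.
move=> a u v /asboolP[n [r [s [Ss ->]]]] /asboolP[k [t [w [Sw ->]]]].
apply/asboolP; exists (n + k)%N.
exists (fun i => match split i with inl j => a * r j | inr j => t j end).
exists (fun i => match split i with inl j => s j | inr j => w j end).
split=> [i|]; first by case: (split i).
rewrite big_split_ord /= scaler_sumr; congr (_ + _); apply: eq_bigr => i _.
  by rewrite scalerA (unsplitK (inl i)).
by rewrite (unsplitK (inr i)).
Qed.

HB.instance Definition _ := GRing.isSubmodClosed.Build R V Rspan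
  Rspan_submod_closed.

End Span.

Section QuotientModule.
Variables (R : comNzRingType) (V : lmodType R) (S : V -> Prop).

Local Notation I := (Rspan S).

Definition quotmod := @Quotient.quot V I.

HB.instance Definition _ := GRing.Zmodule.on quotmod.

Definition quotmod_pi (x : V) : quotmod := \pi_(@Quotient.quot V I)%qT x.

Definition quotmod_scale (r : R) (x : quotmod) : quotmod :=
  quotmod_pi (r *: generic_quotient.repr (x : @Quotient.quot V I)).

Fact quotmod_piZ r x : quotmod_scale r (quotmod_pi x) = quotmod_pi (r *: x).
Proof.
apply/eqP; rewrite -Quotient.idealrBE -scalerBr; apply: rpredZ.
by rewrite Quotient.idealrBE reprK.
Qed.

Fact quotmod_piP (x : quotmod) : exists y, x = quotmod_pi y.
Proof. by exists (generic_quotient.repr (x : @Quotient.quot V I)); rewrite /quotmod_pi reprK. Qed.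

Fact quotmod_piD x y : quotmod_pi (x + y) = quotmod_pi x + quotmod_pi y.
Proof. exact: (raddfD (\pi_(@Quotient.quot V I)%qT)). Qed.

Fact quotmod_scaleA a b x :
  quotmod_scale a (quotmod_scale b x) = quotmod_scale (a * b) x.
Proof. by have [y ->] := quotmod_piP x; rewrite !quotmod_piZ scalerA. Qed.
Fact quotmod_scale1 : left_id 1 quotmod_scale.
Proof.
by move=> x; have [y ->] := quotmod_piP x; rewrite quotmod_piZ scale1r.
Qed.
Fact quotmod_scaleDr : right_distributive quotmod_scale +%R.
Proof.
move=> a x y; have [u ->] := quotmod_piP x; have [v ->] := quotmod_piP y.
by rewrite -quotmod_piD !quotmod_piZ scalerDr quotmod_piD.
Qed.
Fact quotmod_scaleDl x : {morph quotmod_scale^~ x : a b / a + b}.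
Proof.
move=> a b; have [u ->] := quotmod_piP x.
by rewrite !quotmod_piZ scalerDl quotmod_piD.
Qed.

HB.instance Definition _ := GRing.Zmodule_isLmodule.Build R quotmod
  quotmod_scaleA quotmod_scale1 quotmod_scaleDr quotmod_scaleDl.

Lemma quotmod_pi_eq0 x : (quotmod_pi x == 0) = (x \in I).
Proof.
have p0 : quotmod_pi 0 = 0 by exact: (raddf0 (\pi_(@Quotient.quot V I)%qT)).
by rewrite -p0 -[in RHS](subr0 x) Quotient.idealrBE.
Qed.

End QuotientModule.

(* A finite group is a [finGroupType], taken as a whole; a subgroup [H] and a
   quotient by [N] become such through [subg_of H] and [coset_of N]. *)

Section MackeyMaps.
Variables (hT kT gT : finGroupType).
Variables (a : {morphism [set: hT] >-> gT}) (b : {morphism [set: kT] >-> gT}).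
Hypotheses (inja : 'injm a) (injb : 'injm b).

(* alpha(H) :&: g beta(K) g^-1; in MathComp [A :^ x] is x^-1 A x. *)
Definition mackey_cap (g : gT) : {group gT} :=
  (a @* [set: hT] :&: (b @* [set: kT]) :^ g^-1)%G.

Definition mackey_phi_fun (g : gT) (x : subg_of (mackey_cap g)) : kT :=
  invm injb ((sgval x) ^ g)%g.

Definition mackey_psi_fun (g : gT) (x : subg_of (mackey_cap g)) : hT :=
  invm inja (sgval x).

Fact mackey_phi_dom g (x : subg_of (mackey_cap g)) :
  (sgval x ^ g)%g \in b @* [set: kT].
Proof. by have /setIP[_] := subgP x; rewrite mem_conjg invgK. Qed.

Fact mackey_psi_dom g (x : subg_of (mackey_cap g)) :
  sgval x \in a @* [set: hT].
Proof. by have /setIP[] := subgP x. Qed.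

Fact mackey_phiM g :
  {in [set: subg_of (mackey_cap g)] &,
     {morph mackey_phi_fun (g := g) : x y / (x * y)%g}}.
Proof.
move=> x y _ _; rewrite /mackey_phi_fun /= conjMg.
by rewrite morphM ?mackey_phi_dom.
Qed.

Fact mackey_psiM g :
  {in [set: subg_of (mackey_cap g)] &,
     {morph mackey_psi_fun (g := g) : x y / (x * y)%g}}.
Proof.
move=> x y _ _; rewrite /mackey_psi_fun /=.
by rewrite morphM ?mackey_psi_dom.
Qed.

Definition mackey_phi g : {morphism [set: subg_of (mackey_cap g)] >-> kT} :=
  Morphism (@mackey_phiM g).

Definition mackey_psi g : {morphism [set: subg_of (mackey_cap g)] >-> hT} :=
  Morphism (@mackey_psiM g).

Fact injm_mackey_phi g : 'injm (mackey_phi g).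
Proof.
apply/injmP => x y _ _ /= /(congr1 b).
rewrite /mackey_phi_fun !invmK ?mackey_phi_dom // => /conjg_inj.
exact: subg_inj.
Qed.

(* Representatives of alpha(H)\G/beta(K). *)
Definition double_coset_reps (X : {set gT}) : Prop :=
  is_transversal X
    [set (a @* [set: hT]) :* g * (b @* [set: kT]) | g in [set: gT]]%g
    [set: gT].

End MackeyMaps.

Definition ind_map (R : comNzRingType) (M : finGroupType -> lmodType R) :=
  forall (hT gT : finGroupType) (a : {morphism [set: hT] >-> gT}),
    'injm a -> {linear M hT -> M gT}.

Definition res_map (R : comNzRingType) (M : finGroupType -> lmodType R) :=
  forall (hT gT : finGroupType) (e : {morphism [set: hT] >-> gT}),
    {linear M gT -> M hT}.

(* Group morphisms are compared pointwise ([=1]), so that the structure maps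
   do not depend on anything but the underlying functions. *)
Record mfi_axioms (R : comNzRingType) (M : finGroupType -> lmodType R)
    (ind : ind_map M) (res : res_map M) : Prop := MFIAxioms {
  mfi1 : forall (kT hT gT : finGroupType)
    (a : {morphism [set: hT] >-> gT}) (b : {morphism [set: kT] >-> hT})
    (c : {morphism [set: kT] >-> gT})
    (inja : 'injm a) (injb : 'injm b) (injc : 'injm c),
    c =1 a \o b ->
    forall x, ind _ _ c injc x = ind _ _ a inja (ind _ _ b injb x);
  mfi2 : forall (kT hT gT : finGroupType)
    (a : {morphism [set: hT] >-> gT}) (b : {morphism [set: kT] >-> hT})
    (c : {morphism [set: kT] >-> gT}),
    c =1 a \o b ->
    forall x, res _ _ c x = res _ _ b (res _ _ a x);
  mfi3 : forall (gT : finGroupType) (a : {morphism [set: gT] >-> gT})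
    (inja : 'injm a) (g : gT),
    (forall x, a x = x ^ g)%g ->
    forall x, res _ _ a x = x /\ ind _ _ a inja x = x;
  mfi4 : forall (gT : finGroupType) (a b : {morphism [set: gT] >-> gT})
    (inja : 'injm a),
    cancel a b -> cancel b a ->
    forall x, ind _ _ a inja x = res _ _ b x;
  mfi5 : forall (hT kT gT : finGroupType)
    (a : {morphism [set: hT] >-> gT}) (b : {morphism [set: kT] >-> gT})
    (inja : 'injm a) (injb : 'injm b) (X : {set gT}),
    double_coset_reps a b X ->
    forall x, res _ _ b (ind _ _ a inja x) =
      \sum_(g in X) ind _ _ (mackey_phi a injb g) (injm_mackey_phi a injb g)
                      (res _ _ (mackey_psi b inja g) x);
  mfi6 : forall (hT hbT gT gbT : finGroupType)
    (e : {morphism [set: hT] >-> hbT}) (d : {morphism [set: gT] >-> gbT})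
    (a : {morphism [set: hT] >-> gT}) (b : {morphism [set: hbT] >-> gbT})
    (inja : 'injm a) (injb : 'injm b),
    e @* [set: hT] = [set: hbT] -> d @* [set: gT] = [set: gbT] ->
    d \o a =1 b \o e ->
    a @* [set: hT] = d @*^-1 (b @* [set: hbT]) ->
    forall x, res _ _ d (ind _ _ b injb x) = ind _ _ a inja (res _ _ e x)
}.

Record MFI (R : comNzRingType) := MkMFI {
  mfi_obj :> finGroupType -> lmodType R;
  mfi_ind : ind_map mfi_obj;
  mfi_res : res_map mfi_obj;
  mfiP : mfi_axioms mfi_ind mfi_res
}.

Record GFI (R : comNzRingType) := MkGFI {
  gfi_obj :> finGroupType -> algebra R;
  gfi_ind : ind_map (fun gT => gfi_obj gT : lmodType R);
  gfi_res : res_map (fun gT => gfi_obj gT : lmodType R);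
  gfiP : mfi_axioms gfi_ind gfi_res;
  gfi_res_monoid : forall (hT gT : finGroupType)
    (e : {morphism [set: hT] >-> gT}), monoid_morphism (gfi_res e);
  gfi_frobr : forall (hT gT : finGroupType)
    (a : {morphism [set: hT] >-> gT}) (inja : 'injm a)
    (x : gfi_obj hT) (y : gfi_obj gT),
    (gfi_ind inja x : gfi_obj gT) * y
      = gfi_ind inja (x * (gfi_res a y : gfi_obj hT));
  gfi_frobl : forall (hT gT : finGroupType)
    (a : {morphism [set: hT] >-> gT}) (inja : 'injm a)
    (x : gfi_obj hT) (y : gfi_obj gT),
    y * (gfi_ind inja x : gfi_obj gT)
      = gfi_ind inja ((gfi_res a y : gfi_obj hT) * x)
}.

Definition gfi_mfi (R : comNzRingType) (F : GFI R) : MFI R := MkMFI (gfiP F).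
Coercion gfi_mfi : GFI >-> MFI.

Section SubModule.
Variables (R : comNzRingType) (V : lmodType R) (S : {pred V}).
Hypothesis S_closed : submod_closed S.

(* [S_closed] is kept as a phantom argument for the sake of the instances. *)
Definition submod of submod_closed S : Type := {x : V | x \in S}.
Local Notation W := (submod S_closed).

HB.instance Definition _ := SubChoice.copy W {x : V | x \in S}.
HB.instance Definition _ := GRing.SubChoice_isSubLmodule.Build R V _ W
  (GRing.submod_closed_semi S_closed).

End SubModule.

Section SubAlgebra.
Variables (R : comNzRingType) (A : algebra R) (S : {pred A}).

Definition subalgebra_closed : Prop :=
  [/\ 1 \in S, linear_closed S & GRing.mulr_2closed S].

Hypothesis S_closed : subalgebra_closed.

Definition subalg_sort of subalgebra_closed : Type := {x : A | x \in S}.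
Local Notation B := (subalg_sort S_closed).

Fact subalg_subring_closed : subring_closed S.
Proof.
have [S1 Slin SM] := S_closed; split=> // x y Sx Sy.
by rewrite addrC -scaleN1r Slin.
Qed.

HB.instance Definition _ := SubChoice.copy B {x : A | x \in S}.
HB.instance Definition _ := GRing.SubChoice_isSubPzRing.Build A _ B
  subalg_subring_closed.

Fact subalg_map_in r : (alg_map A r : A) \in S.
Proof.
have [S1 Slin _] := S_closed.
have S0 : 0 \in S by rewrite -(addNr 1) -scaleN1r Slin.
by rewrite -[alg_map A r : A]mulr1 -alg_scaleE -[_ *: _]addr0 Slin.
Qed.

Definition subalg_map (r : R) : B :=
  exist (fun x : A => x \in S) (alg_map A r) (subalg_map_in r).

Fact subalg_map_zmod : zmod_morphism subalg_map.
Proof. by move=> x y; apply: val_inj; rewrite /= raddfB. Qed.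
Fact subalg_map_monoid : monoid_morphism subalg_map.
Proof.
by split=> [|x y]; apply: val_inj; rewrite /= (rmorph1, rmorphM).
Qed.
HB.instance Definition _ := GRing.isZmodMorphism.Build R B subalg_map
  subalg_map_zmod.
HB.instance Definition _ := GRing.isMonoidMorphism.Build R B subalg_map
  subalg_map_monoid.

Fact subalg_mapC r x : subalg_map r * x = x * subalg_map r.
Proof. by apply: val_inj; rewrite /= (alg_mapC r). Qed.

Definition subalg : algebra R := Algebra subalg_mapC.

Definition subalg_val (x : subalg) : A := \val (x : B).

End SubAlgebra.

Section RestrictSubmod.
Variables (R : comNzRingType) (U V : lmodType R).
Variables (S : {pred U}) (T : {pred V}).
Variables (S_closed : submod_closed S) (T_closed : submod_closed T).
Variables (f : {linear U -> V}) (fST : {in S, forall x, f x \in T}).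

Definition restrict_submod (x : submod S_closed) : submod T_closed :=
  exist (fun y : V => y \in T) (f (\val x)) (fST (valP x)).

Fact restrict_submod_linear : linear restrict_submod.
Proof. by move=> r x y; apply: val_inj; rewrite /= linearP. Qed.

HB.instance Definition _ := GRing.isLinear.Build R _ _ _ restrict_submod
  restrict_submod_linear.
End RestrictSubmod.
Arguments restrict_submod {R U V S T} S_closed T_closed {f} fST x.

Section RestrictSubalg.
Variables (R : comNzRingType) (A B : algebra R).
Variables (S : {pred A}) (T : {pred B}).
Variables (S_closed : subalgebra_closed S) (T_closed : subalgebra_closed T).
Variables (f : {linear A -> B}) (fST : {in S, forall x, f x \in T}).

Definition restrict_subalg (x : subalg S_closed) : subalg T_closed :=
  exist (fun y : B => y \in T) (f (subalg_val x))
    (fST (valP (x : subalg_sort S_closed))).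

Fact restrict_subalg_linear : linear restrict_subalg.
Proof.
move=> r x y; apply: val_inj; rewrite /=.
exact: (linearP f r (subalg_val x) (subalg_val y)).
Qed.

HB.instance Definition _ := GRing.isLinear.Build R _ _ _ restrict_subalg
  restrict_subalg_linear.
End RestrictSubalg.
Arguments restrict_subalg {R A B S T} S_closed T_closed {f} fST x.

Section SubMFI.
Variables (R : comNzRingType) (M : MFI R).
Variable S : forall gT : finGroupType, {pred M gT}.
Arguments S : clear implicits.
Hypothesis S_closed : forall gT, submod_closed (S gT).
Hypothesis S_ind : forall (hT gT : finGroupType)
  (a : {morphism [set: hT] >-> gT}) (inja : 'injm a),
  {in S hT, forall x, mfi_ind M inja x \in S gT}.
Hypothesis S_res : forall (hT gT : finGroupType)
  (e : {morphism [set: hT] >-> gT}),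
  {in S gT, forall x, mfi_res M e x \in S hT}.

Definition sub_mfi_obj (gT : finGroupType) : lmodType R :=
  submod (S_closed gT).

Definition sub_mfi_ind : ind_map sub_mfi_obj := fun hT gT a inja =>
  restrict_submod (S_closed hT) (S_closed gT) (@S_ind _ _ a inja).

Definition sub_mfi_res : res_map sub_mfi_obj := fun hT gT e =>
  restrict_submod (S_closed gT) (S_closed hT) (@S_res _ _ e).

Fact sub_mfi_axioms : mfi_axioms sub_mfi_ind sub_mfi_res.
Proof.
have [P1 P2 P3 P4 P5 P6] := mfiP M; split.
- by move=> kT hT gT a b c ia ib ic E x; apply: val_inj; apply: P1.
- by move=> kT hT gT a b c E x; apply: val_inj; apply: P2.
- move=> gT a ia g E x; have [h1 h2] := P3 _ _ ia _ E (\val x).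
  by split; apply: val_inj.
- by move=> gT a b ia ab ba x; apply: val_inj; apply: P4.
- move=> hT kT gT a b ia ib X HX x; apply: val_inj.
  rewrite [RHS]raddf_sum /=; exact: P5.
- move=> hT hbT gT gbT e d a b ia ib he hd c1 c2 x.
  by apply: val_inj; apply: P6.
Qed.

Definition sub_mfi : MFI R := MkMFI sub_mfi_axioms.
End SubMFI.

Section SubGFI.
Variables (R : comNzRingType) (F : GFI R).
Variable S : forall gT : finGroupType, {pred gfi_obj F gT}.
Arguments S : clear implicits.
Hypothesis S_closed : forall gT, subalgebra_closed (S gT).
Hypothesis S_ind : forall (hT gT : finGroupType)
  (a : {morphism [set: hT] >-> gT}) (inja : 'injm a),
  {in S hT, forall x, gfi_ind F inja x \in S gT}.
Hypothesis S_res : forall (hT gT : finGroupType)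
  (e : {morphism [set: hT] >-> gT}),
  {in S gT, forall x, gfi_res F e x \in S hT}.

Definition sub_gfi_obj (gT : finGroupType) : algebra R := subalg (S_closed gT).

Definition sub_gfi_ind : ind_map (fun gT => sub_gfi_obj gT : lmodType R) :=
  fun hT gT a inja =>
    restrict_subalg (S_closed hT) (S_closed gT) (@S_ind _ _ a inja).

Definition sub_gfi_res : res_map (fun gT => sub_gfi_obj gT : lmodType R) :=
  fun hT gT e => restrict_subalg (S_closed gT) (S_closed hT) (@S_res _ _ e).

Fact sub_gfi_axioms : mfi_axioms sub_gfi_ind sub_gfi_res.
Proof.
have [P1 P2 P3 P4 P5 P6] := gfiP F; split.
- by move=> kT hT gT a b c ia ib ic E x; apply: val_inj; apply: P1.
- by move=> kT hT gT a b c E x; apply: val_inj; apply: P2.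
- move=> gT a ia g E x; have [h1 h2] := P3 _ _ ia _ E (subalg_val x).
  by split; apply: val_inj.
- by move=> gT a b ia ab ba x; apply: val_inj; apply: P4.
- move=> hT kT gT a b ia ib X HX x; apply: val_inj.
  apply: (etrans (P5 _ _ _ a b ia ib X HX (subalg_val x))).
  rewrite (raddf_sum (\val : subalg_sort (S_closed kT) -> gfi_obj F kT)).
  by [].
- move=> hT hbT gT gbT e d a b ia ib he hd c1 c2 x.
  by apply: val_inj; apply: P6.
Qed.

Fact sub_gfi_res_monoid (hT gT : finGroupType)
  (e : {morphism [set: hT] >-> gT}) : monoid_morphism (sub_gfi_res e).
Proof.
have [e1 eM] := gfi_res_monoid F e.
by split=> [|x y]; apply: val_inj; [apply: e1 | apply: eM].
Qed.

Fact sub_gfi_frobr (hT gT : finGroupType)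
    (a : {morphism [set: hT] >-> gT}) (inja : 'injm a)
    (x : sub_gfi_obj hT) (y : sub_gfi_obj gT) :
  (sub_gfi_ind inja x : sub_gfi_obj gT) * y
    = sub_gfi_ind inja (x * (sub_gfi_res a y : sub_gfi_obj hT)).
Proof. by apply: val_inj; apply: gfi_frobr. Qed.

Fact sub_gfi_frobl (hT gT : finGroupType)
    (a : {morphism [set: hT] >-> gT}) (inja : 'injm a)
    (x : sub_gfi_obj hT) (y : sub_gfi_obj gT) :
  y * (sub_gfi_ind inja x : sub_gfi_obj gT)
    = sub_gfi_ind inja ((sub_gfi_res a y : sub_gfi_obj hT) * x).
Proof. by apply: val_inj; apply: gfi_frobl. Qed.

Definition sub_gfi : GFI R :=
  MkGFI sub_gfi_axioms sub_gfi_res_monoid sub_gfi_frobr sub_gfi_frobl.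
End SubGFI.

Record GFI_morphism (R : comNzRingType) (F G : GFI R) := MkGFIMorphism {
  gfi_mor :> forall gT : finGroupType, {linear gfi_obj F gT -> gfi_obj G gT};
  gfi_mor_monoid : forall gT : finGroupType, monoid_morphism (gfi_mor gT);
  gfi_mor_ind : forall (hT gT : finGroupType)
    (a : {morphism [set: hT] >-> gT}) (inja : 'injm a) x,
    gfi_mor gT (gfi_ind F inja x) = gfi_ind G inja (gfi_mor hT x);
  gfi_mor_res : forall (hT gT : finGroupType)
    (e : {morphism [set: hT] >-> gT}) x,
    gfi_mor hT (gfi_res F e x) = gfi_res G e (gfi_mor gT x)
}.

Section KernelImage.
Variables (R : comNzRingType) (F G : GFI R) (m : GFI_morphism F G).

Definition ker_pred (gT : finGroupType) : {pred gfi_mfi F gT} :=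
  fun x => m gT x == 0.

Fact ker_closed gT : submod_closed (@ker_pred gT).
Proof.
split=> [|a x y]; rewrite !unfold_in /= ?raddf0 // => /eqP kx /eqP ky.
by rewrite linearP kx ky scaler0 addr0.
Qed.

Fact ker_ind (hT gT : finGroupType) (a : {morphism [set: hT] >-> gT})
    (inja : 'injm a) :
  {in @ker_pred hT, forall x, mfi_ind F inja x \in @ker_pred gT}.
Proof.
by move=> x /eqP kx; rewrite unfold_in /= gfi_mor_ind kx raddf0.
Qed.

Fact ker_res (hT gT : finGroupType) (e : {morphism [set: hT] >-> gT}) :
  {in @ker_pred gT, forall x, mfi_res F e x \in @ker_pred hT}.
Proof.
by move=> x /eqP kx; rewrite unfold_in /= gfi_mor_res kx raddf0.
Qed.

Definition kernel_mfi : MFI R := sub_mfi ker_closed ker_ind ker_res.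

Definition ker_val (gT : finGroupType) (x : kernel_mfi gT) : gfi_obj F gT :=
  \val (x : submod (ker_closed gT)).

Fact ker_mul_in (gT : finGroupType) (d : gfi_obj F gT) (x : kernel_mfi gT) :
  d * ker_val x \in @ker_pred gT.
Proof.
have [_ mM] := gfi_mor_monoid m gT.
have /eqP kx := valP (x : submod (ker_closed gT)).
by apply/eqP; rewrite mM [m gT (ker_val x)]kx mulr0.
Qed.

(* The product in F(G) of an element of F(G) and one of the ideal K(G). *)
Definition ker_mul (gT : finGroupType) (d : gfi_obj F gT)
    (x : kernel_mfi gT) : kernel_mfi gT :=
  exist (fun y : gfi_mfi F gT => y \in @ker_pred gT) (d * ker_val x)
    (ker_mul_in d x).

Definition im_pred (gT : finGroupType) : {pred gfi_obj G gT} :=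
  fun y => `[< exists x, y = m gT x >].

Fact im_closed gT : subalgebra_closed (@im_pred gT).
Proof.
have [m1 mM] := gfi_mor_monoid m gT.
split=> [|a _ _ /asboolP[x ->] /asboolP[y ->]|
         _ _ /asboolP[x ->] /asboolP[y ->]]; apply/asboolP.
- by exists 1; rewrite m1.
- by exists (a *: x + y); rewrite linearP.
- by exists (x * y); rewrite mM.
Qed.

Fact im_ind (hT gT : finGroupType) (a : {morphism [set: hT] >-> gT})
    (inja : 'injm a) :
  {in @im_pred hT, forall x, gfi_ind G inja x \in @im_pred gT}.
Proof.
move=> _ /asboolP[x ->]; apply/asboolP.
by exists (gfi_ind F inja x); rewrite gfi_mor_ind.
Qed.

Fact im_res (hT gT : finGroupType) (e : {morphism [set: hT] >-> gT}) :
  {in @im_pred gT, forall x, gfi_res G e x \in @im_pred hT}.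
Proof.
move=> _ /asboolP[x ->]; apply/asboolP.
by exists (gfi_res F e x); rewrite gfi_mor_res.
Qed.

Definition image_gfi : GFI R := sub_gfi im_closed im_ind im_res.

End KernelImage.

Section Primordial.
Variables (R : comNzRingType) (M : MFI R) (gT : finGroupType).

Definition Ind (H : {group gT}) : {linear M (subg_of H) -> M gT} :=
  mfi_ind M (injm_sgval H).

Definition quo_morphism (N : {group gT}) (nN : N <| [set: gT]) :
    {morphism [set: gT] >-> coset_of N} :=
  restrm_morphism (normal_norm nN) (coset_morphism N).

Definition Inf (N : {group gT}) (nN : N <| [set: gT]) :
    {linear M (coset_of N) -> M gT} :=
  mfi_res M (quo_morphism nN).

Definition proper_ind (x : M gT) : Prop :=
  exists (H : {group gT}) (y : M (subg_of H)),
    H \proper [set: gT] /\ x = Ind H y.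

Definition proper_inf (x : M gT) : Prop :=
  exists (N : {group gT}) (nN : N <| [set: gT]) (y : M (coset_of N)),
    N :!=: 1%g /\ x = Inf nN y.

Definition Iind : {pred M gT} := Rspan proper_ind.

Definition primordial : Prop := [set: gT] = 1%g \/ ~ (Iind =i predT).

End Primordial.
Arguments Ind {R} M {gT} H.
Arguments Inf {R} M {gT N} nN.
Arguments proper_ind {R} M gT x.
Arguments proper_inf {R} M gT x.
Arguments Iind {R} M gT.
Arguments primordial {R} M gT.

Section Prim.
Variables (R : comNzRingType) (F G : GFI R) (m : GFI_morphism F G).
Variables (gT : finGroupType) (D : {pred gfi_obj F gT}).
Local Notation K := (kernel_mfi m).

Definition imprim_base : {pred K gT} :=
  Rspan (fun x => proper_ind K gT x \/ proper_inf K gT x).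

Definition imprim_gen (z : K gT) : Prop :=
  exists d y, [/\ d \in D, y \in imprim_base & z = ker_mul d y].

Definition Imprim : {pred K gT} := Rspan imprim_gen.

Definition Prim : lmodType R := quotmod imprim_gen.

Lemma Prim_nontrivialP :
  (exists p : Prim, p != 0) <-> exists x : K gT, x \notin Imprim.
Proof.
split=> [[p]|[x xI]]; last by exists (quotmod_pi _ x); rewrite quotmod_pi_eq0.
by have [x ->] := quotmod_piP p; rewrite quotmod_pi_eq0; exists x.
Qed.

End Prim.

(* The group structure is attached to dependent finite functions, hence the
   constant family. *)
Definition gpow (S : finGroupType) (d : nat) : finGroupType :=
  {dffun forall i : 'I_d, (fun=> S) i}.

Definition extension (nT gT hT : finGroupType) : Prop :=
  exists (i : {morphism [set: nT] >-> gT}) (p : {morphism [set: gT] >-> hT}),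
    [/\ 'injm i, i @* [set: nT] = 'ker p & p @* [set: gT] = [set: hT]].

Definition torsion_free (R : comNzRingType) (V : lmodType R) : Prop :=
  forall (r : R) (v : V), r *: v = 0 -> r = 0 \/ v = 0.

(* Main.v *)
Require Import Defs.
From mathcomp Require Import all_boot all_order all_algebra all_fingroup.
From mathcomp Require Import all_solvable boolp.

Set Implicit Arguments.
Unset Strict Implicit.
Unset Printing Implicit Defensive.

Import GroupScope GRing.Theory.
Local Open Scope ring_scope.

(** Let N be any minimal normal subgroup of G.  Being characteristically
    simple, N is a direct power of a simple group, so G is an extension of
    G / N by some S ^ d with d > 0 ([minnormal_gpow]).  The claim is that
    H := G / N is primordial for the image of m; otherwise Prim vanishes
    ([nonprimordial_quotient_Imprim]), for the following reason.

    If H is not primordial, the unit of (Im m)(H) is a sum of elements induced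
    from proper subgroups.  Lifting these elements to F gives i in I_F(H) with
    1 - i in K(H) ([nonprimordial_image]).  Inflate to G: k := Inf (1 - i) lies
    in K(G) and has the form 1 - j, where j := Inf i belongs to I_F(G), because
    inflation turns an element induced from a proper subgroup of G / N into one
    induced from its preimage in G ([Inf_Ind]).  Each x in K(G) is then
    j x + k x, and both terms are imprimitive:
    - by Frobenius reciprocity I_F(G) K(G) and K(G) I_F(G) are contained in
      I_K(G), which takes care of j x ([Iind_ker_mul]);
    - since F(G) is spanned by I_F(G) and D(G), k x is a combination of terms
      k z with z in I_F(G), again in I_K(G) ([Iind_ker_mulr]), and of terms
      k z = z k with z in D(G), which lie in D(G) Inf K(G / N).
    Thus K(G) = Imprim(G). *)

(** * Spans *)

Lemma Rspan_ind (R : comNzRingType) (V : lmodType R) (S T : V -> Prop) :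
    T 0 -> (forall r u v, T u -> T v -> T (r *: u + v)) ->
    (forall s, S s -> T s) ->
  forall v, v \in Rspan S -> T v.
Proof.
move=> T0 Tlin ST _ /asboolP[n [r [s [Ss ->]]]].
elim/big_ind: _ => // [u v Tu Tv | i _].
  by rewrite -[u]scale1r; apply: Tlin.
by rewrite -[_ *: _]addr0; apply: Tlin => //; apply: ST.
Qed.

Lemma mem_Rspan (R : comNzRingType) (V : lmodType R) (S : V -> Prop) s :
  S s -> s \in Rspan S.
Proof.
move=> Ss; apply/asboolP; exists 1%N, (fun=> 1), (fun=> s); split=> //.
by rewrite big_ord1 scale1r.
Qed.

Lemma Rspan_linear (R : comNzRingType) (V W : lmodType R) (f : V -> W)
    (S : V -> Prop) (T : W -> Prop) :
    linear f -> (forall s, S s -> f s \in Rspan T) ->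
  forall v, v \in Rspan S -> f v \in Rspan T.
Proof.
move=> f_lin fS; apply: Rspan_ind => // [|r u v fu fv].
  have f0 : f 0 = 0.
    by have := f_lin (-1) 0 0; rewrite scaler0 addr0 scaleN1r addNr.
  by rewrite f0 rpred0.
by rewrite f_lin rpredD ?rpredZ.
Qed.

(** * Minimal normal subgroups as powers of simple groups *)

Lemma mem_bigcprod (gT : finGroupType) (I : Type) (r : seq I)
    (B : I -> {set gT}) (N : {group gT}) (x : I -> gT) :
    (\big[cprod/1]_(i <- r) B i)%g = N -> (forall i, x i \in B i) ->
  (\prod_(i <- r) x i)%g \in N.
Proof.
move=> /bigcprodW <- Bx; elim: r => [|i r IHr]; first by rewrite !big_nil set11.
by rewrite !big_cons mem_mulg.
Qed.

(** A single factor B i need not be commutative: the rearrangement only moves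
    each y i past the x j with j after i, and never past x i. *)
Lemma bigcprod_prodM (gT : finGroupType) (I : Type) (r : seq I)
    (B : I -> {set gT}) (N : {group gT}) (x y : I -> gT) :
    (\big[cprod/1]_(i <- r) B i)%g = N ->
    (forall i, x i \in B i) -> (forall i, y i \in B i) ->
  (\prod_(i <- r) (x i * y i) = \prod_(i <- r) x i * \prod_(i <- r) y i)%g.
Proof.
move=> defN Bx By; elim: r N defN => [|i r IHr] N.
  by rewrite !big_nil mulg1.
rewrite !big_cons => /cprodP[[H K defH defK] _ cBK].
rewrite (IHr K defK) -!mulgA; congr (_ * _)%g; rewrite !mulgA.
congr (_ * _)%g; apply/commute_sym/(centsP cBK); last exact: By.
by rewrite defK (mem_bigcprod defK).
Qed.

(** An internal direct product of d copies of S is the image of the external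
    power: multiply the components.  Factors commuting with one another make
    this a morphism, and uniqueness of decompositions makes it injective. *)
Lemma bigdprod_gpow (gT S : finGroupType) (d : nat) (B : 'I_d -> {set gT})
    (N : {group gT}) (phi : forall i : 'I_d, {morphism [set: S] >-> gT}) :
    (forall i, 'injm (phi i)) -> (forall i, phi i @* [set: S] = B i) ->
    \big[dprod/1%g]_(i < d) B i = N ->
  exists f : {morphism [set: gpow S d] >-> gT},
    'injm f /\ f @* [set: gpow S d] = N.
Proof.
move=> inj_phi im_phi defN.
have Bphi i s : phi i s \in B i by rewrite -im_phi mem_morphim ?inE.
pose f (x : gpow S d) := (\prod_(i < d) phi i (x i))%g.
have fM : {in [set: gpow S d] &, {morph f : x y / (x * y)%g}}.
  move=> x y _ _; rewrite -(bigcprod_prodM (bigdprodWcp defN)) //.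
  by apply: eq_bigr => i _; rewrite ffunE morphM ?inE.
exists (Morphism fM); split.
  apply/injmP => x y _ _ /= fxy.
  have fxN : f x \in N by rewrite -(bigdprodW defN) mem_prodg.
  have [c [_ _ c_uniq]] := mem_bigdprod defN fxN.
  apply/ffunP => i; apply: (injmP (inj_phi i)); rewrite ?inE //.
  transitivity (c i); [| symmetry].
    by apply: (c_uniq (fun i => phi i (x i))).
  by apply: (c_uniq (fun i => phi i (y i))).
apply/setP=> z; apply/morphimP/idP => [[x _ _ ->] | ].
  by rewrite /= -(bigdprodW defN) mem_prodg.
rewrite -(bigdprodW defN) => /prodsgP[c Bc ->].
have /fin_all_exists[s Ds] i : exists s, c i = phi i s.
  by have := Bc i isT; rewrite -im_phi => /morphimP[s _ _ ->]; exists s.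
exists [ffun i => s i]; rewrite ?inE //.
by apply: eq_bigr => i _; rewrite ffunE.
Qed.

(** Minimal normal subgroups are characteristically simple, hence direct
    products of the images of one simple subgroup H under automorphisms; each
    of these automorphisms identifies one factor with H. *)
Lemma minnormal_gpow (gT : finGroupType) (G N : {group gT}) :
    minnormal N G ->
  exists (S : finGroupType) (d : nat) (f : {morphism [set: gpow S d] >-> gT}),
    [/\ simple [set: S], (0 < d)%N, 'injm f & f @* [set: gpow S d] = N].
Proof.
move=> minN; have [/andP[ntN _] _] := mingroupP minN.
have [H [sHN simH [I sIA]]] := charsimple_dprod (minnormal_charsimple minN).
rewrite big_enum_val => defN.
have AutI (i : 'I_#|I|) : enum_val i \in Aut N.
  by apply: (subsetP sIA); apply: enum_valP.
have phiM (i : 'I_#|I|) :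
    {in [set: subg_of H] &, {morph enum_val i \o sgval : x y / (x * y)%g}}.
  move=> x y _ _ /=; rewrite -!(autmE (AutI i)) morphM //;
  by apply: (subsetP sHN); apply: subgP.
have [|i|f [injf imf]] :=
    @bigdprod_gpow _ _ _ _ N (fun i => Morphism (phiM i)) _ _ defN.
- by move=> i; apply/injmP => x y _ _ /= /perm_inj/subg_inj.
- apply/setP=> z; apply/morphimP/imsetP => [[x _ _ ->]|[x Hx ->]].
    by exists (sgval x); rewrite ?subgP.
  by exists (subg H x); rewrite ?inE //= subgK.
exists (subg_of H), #|I|, f; split=> //.
  by rewrite -(isog_simple (isog_subg H)).
(* An empty product would be trivial, whereas N is not. *)
rewrite lt0n; apply: contraNneq ntN => I0.
by rewrite -defN big1 // => i _; have := ltn_ord i; rewrite [X in (_ < X)%N]I0.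
Qed.

Section QuotientMap.
Variables (gT : finGroupType) (N : {group gT}) (nN : N <| [set: gT]).

Lemma quo_morphism_onto : quo_morphism nN @* [set: gT] = [set: coset_of N].
Proof.
rewrite morphim_restrm setIid; apply/setP=> z; rewrite inE.
have [x Nx ->] := cosetP z.
by rewrite mem_morphim // inE.
Qed.

Lemma ker_quo_morphism : 'ker (quo_morphism nN) = N.
Proof.
by rewrite ker_restrm ker_coset; apply/setIidPr; apply: normal_sub.
Qed.

End QuotientMap.

(** * Inflation and induction *)

(** The square formed by U, its preimage W in G, G / N and G is cartesian, so
    (MFI 6) rewrites Inf (Ind y) as the induction from W of the inflation of y
    along W -> U; and W is proper because G maps onto G / N. *)
Lemma Inf_Ind (R : comNzRingType) (M : MFI R) (gT : finGroupType)
    (N : {group gT}) (nN : N <| [set: gT]) (U : {group coset_of N})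
    (y : M (subg_of U)) :
    U \proper [set: coset_of N] -> proper_ind M gT (Inf M nN (Ind M U y)).
Proof.
move=> prU; pose q := quo_morphism nN.
pose W := (q @*^-1 U)%G.
have qE x : q x = coset N x by [].
have WU x : (x \in W) = (q x \in U) by rewrite !inE.
have eM : {in [set: subg_of W] &,
    {morph (fun x : subg_of W => subg U (q (sgval x))) : x y / (x * y)%g}}.
  move=> u v _ _; apply: subg_inj => /=.
  have [Uu Uv] : q (sgval u) \in U /\ q (sgval v) \in U.
    by rewrite -!WU !subgP.
  by rewrite morphM ?inE // !subgK ?groupM.
pose e := Morphism eM.
have eE u : sgval (e u) = q (sgval u) by rewrite subgK // -WU subgP.
have q_onto z : exists x, z = q x.
  have : z \in [set: coset_of N] by rewrite inE.
  by rewrite -(quo_morphism_onto nN) => /morphimP[x _ _ ->]; exists x.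
exists W, (mfi_res M e y); split.
  have [_ [z _ U'z]] := properP prU.
  apply/properP; split; first exact: subsetT.
  by have [x Dz] := q_onto z; exists x; rewrite ?in_setT // WU -Dz.
have [_ _ _ _ _ P6] := mfiP M; apply: P6.
- apply/setP=> z; rewrite [RHS]inE; have [x Dz] := q_onto (sgval z).
  have Wx : x \in W by rewrite WU -Dz subgP.
  apply/morphimP; exists (subg W x); rewrite ?in_setT //.
  by apply: subg_inj; rewrite eE subgK.
- exact: quo_morphism_onto.
- by move=> w; apply/esym/eE.
- apply/setP=> x; apply/morphimP/idP => [[w _ _ ->]|].
    rewrite !inE; apply/morphimP.
    by exists (e w); rewrite ?in_setT //; apply/esym/eE.
  rewrite !inE => /= /morphimP[u _ _ qx].
  have Wx : x \in W by rewrite WU [q x]qx subgP.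
  by exists (subg W x); rewrite ?in_setT //= subgK.
Qed.

Lemma Inf_Iind (R : comNzRingType) (M : MFI R) (gT : finGroupType)
    (N : {group gT}) (nN : N <| [set: gT]) (x : M (coset_of N)) :
  x \in Iind M (coset_of N) -> Inf M nN x \in Iind M gT.
Proof.
apply: Rspan_linear => [|_ [U [y [prU ->]]]]; first exact: linearP.
by apply: mem_Rspan; apply: Inf_Ind.
Qed.

(** * The kernel of a morphism of Green functors *)

Section Kernel.
Variables (R : comNzRingType) (F G : GFI R) (m : GFI_morphism F G).
Local Notation K := (kernel_mfi m).

Lemma ker_val_inj (gT : finGroupType) : injective (@ker_val _ _ _ m gT).
Proof. exact: val_inj. Qed.

Lemma ker_val_linear (gT : finGroupType) : linear (@ker_val _ _ _ m gT).
Proof. by []. Qed.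

Lemma ker_mulr_in (gT : finGroupType) (x : K gT) (d : gfi_obj F gT) :
  ker_val x * d \in @ker_pred _ _ _ m gT.
Proof.
have [_ mM] := gfi_mor_monoid m gT.
have /eqP kx := valP (x : submod (ker_closed m gT)).
by apply/eqP; rewrite mM [m gT (ker_val x)]kx mul0r.
Qed.

(** The right-hand counterpart of [ker_mul].  Both are needed: F(G) is not
    assumed commutative, and the decomposition x = j x + (1 - j) x multiplies
    x on the left, while x itself has to be expanded along D(G) and I_F(G). *)
Definition ker_mulr (gT : finGroupType) (x : K gT) (d : gfi_obj F gT) : K gT :=
  exist (fun y : gfi_mfi F gT => y \in @ker_pred _ _ _ m gT) (ker_val x * d)
    (ker_mulr_in x d).

Lemma ker_mul_linear (gT : finGroupType) (x : K gT) :
  linear (fun d : gfi_obj F gT => ker_mul d x).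
Proof.
move=> r u v; apply: ker_val_inj; rewrite ker_val_linear /ker_val /=.
by rewrite mulrDl alg_scaleAl.
Qed.

Lemma ker_mulr_linear (gT : finGroupType) (x : K gT) : linear (ker_mulr x).
Proof.
move=> r u v; apply: ker_val_inj; rewrite ker_val_linear /ker_val /=.
by rewrite mulrDr alg_scaleAr.
Qed.

(** Frobenius reciprocity: Ind y * x = Ind (y * Res x), where Res x is again in
    the kernel. *)
Lemma Iind_ker_mul (gT : finGroupType) (i : gfi_obj F gT) (x : K gT) :
  i \in Iind F gT -> ker_mul i x \in Iind K gT.
Proof.
move: i; apply: (Rspan_linear (ker_mul_linear x)) => _ [H [y [prH ->]]].
apply: mem_Rspan; exists H, (ker_mul y (mfi_res K (sgval_morphism H) x)).
by split=> //; apply: ker_val_inj; apply: gfi_frobr.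
Qed.

Lemma Iind_ker_mulr (gT : finGroupType) (x : K gT) (i : gfi_obj F gT) :
  i \in Iind F gT -> ker_mulr x i \in Iind K gT.
Proof.
move: i; apply: (Rspan_linear (ker_mulr_linear x)) => _ [H [y [prH ->]]].
apply: mem_Rspan; exists H, (ker_mulr (mfi_res K (sgval_morphism H) x) y).
by split=> //; apply: ker_val_inj; apply: gfi_frobl.
Qed.

(** Taking images commutes with induction, so that induced elements of the
    image lift to induced elements. *)
Lemma Iind_image (gT : finGroupType) (y : image_gfi m gT) :
  y \in Iind (image_gfi m) gT ->
  exists2 x : gfi_obj F gT, x \in Iind F gT & subalg_val y = m gT x.
Proof.
move: y; apply: (@Rspan_ind _ _ _ (fun y : image_gfi m gT =>
  exists2 x : gfi_obj F gT, x \in Iind F gT & subalg_val y = m gT x)).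
- by exists 0; rewrite ?rpred0 ?raddf0.
- move=> r y z [u Iu Du] [v Iv Dv]; exists (r *: u + v).
    by rewrite rpredD ?rpredZ.
  by rewrite [RHS]linearP -Du -Dv.
move=> _ [H [z [prH ->]]].
have /asboolP[w Dw] := valP (z : subalg_sort (im_closed m (subg_of H))).
exists (Ind F H w); first by apply: mem_Rspan; exists H, w.
by rewrite [RHS]gfi_mor_ind -Dw.
Qed.

(** Only the unit has to be lifted: since proper induction reaches all of the
    image, it reaches 1, and 1 minus a lift is then an element of the kernel
    congruent to 1 modulo I_F(G). *)
Lemma nonprimordial_image (gT : finGroupType) :
    ~ primordial (image_gfi m) gT ->
  exists2 i : gfi_obj F gT, i \in Iind F gT & m gT (1 - i) = 0.
Proof.
move/not_orP=> [_ /contrapT IT].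
have [m1 _] := gfi_mor_monoid m gT.
have [i Ii mi] := @Iind_image gT (1 : subalg_sort (im_closed m gT)) (IT _).
exists i => //; apply: (etrans (raddfB (m gT) _ _)).
by apply/eqP; rewrite subr_eq0; apply/eqP; apply: (etrans m1 mi).
Qed.

Lemma sub_Imprim (gT : finGroupType) (D : {pred gfi_obj F gT}) (y : K gT) :
  1 \in D -> y \in @imprim_base _ _ _ m gT -> y \in @Imprim _ _ _ m gT D.
Proof.
move=> D1 By; apply: mem_Rspan; exists 1, y; split=> //.
by apply: ker_val_inj; rewrite /ker_val /= mul1r.
Qed.

Lemma Iind_imprim_base (gT : finGroupType) (y : K gT) :
  y \in Iind K gT -> y \in @imprim_base _ _ _ m gT.
Proof.
by apply: (@Rspan_linear _ _ _ idfun) => // s Is; apply: mem_Rspan; left.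
Qed.

(** The vanishing of Prim: an element of K(G / N) of the form 1 - i, with i
    properly induced, inflates to an element k = 1 - j of the imprimitive part
    acting as the identity modulo I_F(G), so that every x in K(G) is imprimitive
    along with j x and k x. *)
Lemma nonprimordial_quotient_Imprim (gT : finGroupType)
    (D : {pred gfi_obj F gT}) (N : {group gT}) (nN : N <| [set: gT]) (x : K gT) :
    1 \in D -> (forall d z : gfi_obj F gT, d \in D -> d * z = z * d) ->
    (forall z : gfi_obj F gT,
       z \in Rspan (fun y => y \in Iind F gT \/ y \in D)) ->
    N :!=: 1%g -> ~ primordial (image_gfi m) (coset_of N) ->
  x \in @Imprim _ _ _ m gT D.
Proof.
move=> D1 cD genF ntN /nonprimordial_image[i Ii mi].
have ki : (1 - i : gfi_mfi F _) \in @ker_pred _ _ _ m _ by apply/eqP.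
pose k0 : K (coset_of N) :=
  exist (fun y : gfi_mfi F _ => y \in @ker_pred _ _ _ m _) (1 - i) ki.
pose k := Inf K nN k0.
pose j : gfi_obj F gT := Inf F nN i.
have Ij : j \in Iind F gT by apply: Inf_Iind.
have kE : ker_val k = 1 - j.
  have [r1 _] := gfi_res_monoid F (quo_morphism nN).
  by rewrite -[in RHS]r1 -raddfB.
have Bk : k \in @imprim_base _ _ _ m gT.
  by apply: mem_Rspan; right; exists N, nN, k0.
(* This is x = j x + (1 - j) x, as k has value 1 - j. *)
have -> : x = ker_mul j x + ker_mulr k (ker_val x).
  apply: ker_val_inj; rewrite -[ker_mul j x]scale1r ker_val_linear scale1r.
  rewrite /ker_val /= -/(ker_val x) -/(ker_val k) kE.
  by rewrite -mulrDl addrC subrK mul1r.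
rewrite rpredD //.
  by apply: sub_Imprim; rewrite // Iind_imprim_base ?Iind_ker_mul.
apply: (Rspan_linear (ker_mulr_linear k) _ (genF (ker_val x))).
move=> z [Iz | Dz].
  by apply: sub_Imprim; rewrite // Iind_imprim_base ?Iind_ker_mulr.
(* Here centrality of D moves z to the left of k, where Imprim expects it. *)
apply: mem_Rspan; exists z, k; split=> //.
by apply: ker_val_inj; apply/esym/cD.
Qed.

End Kernel.

(** * Structure of the groups with non-trivial primitive quotient *)

Theorem theorem4p7 (R : idomainType) (F G : GFI R) (m : GFI_morphism F G)
    (torsF : forall hT : finGroupType, torsion_free (F hT))
    (gT : finGroupType) (D : {pred F gT})
    (D_subalg : subalgebra_closed D)
    (D_central : forall d x : F gT, d \in D -> d * x = x * d)
    (F_gen : forall x : F gT,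
       x \in Rspan (fun y => y \in Iind F gT \/ y \in D))
    (G_nontriv : [set: gT] != 1%g)
    (Prim_nontriv : exists p : Prim m D, p != 0) :
  exists (S : finGroupType) (d : nat) (hT : finGroupType),
    [/\ simple [set: S], (0 < d)%N, extension (gpow S d) gT hT
      & primordial (image_gfi m) hT].
Proof.
have [x /negP xP] := (Prim_nontrivialP m D).1 Prim_nontriv.
have [N minN _] := @minnormal_exists gT [set: gT] [set: gT] G_nontriv
  (normG [set: gT]%G).
have [/andP[ntN nNG] _] := mingroupP minN.
have nN : N <| [set: gT] by rewrite /normal subsetT.
have [S [d [f [simS d_gt0 injf imf]]]] := minnormal_gpow minN.
exists S, d, (coset_of N); split=> //.
  exists f, (quo_morphism nN).
  by split; rewrite ?ker_quo_morphism ?quo_morphism_onto.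
have [D1 _ _] := D_subalg.
by apply: contrapT => npr; apply: xP; apply: nonprimordial_quotient_Imprim npr.
Qed.
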